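(* Let $(Z,d_Z)$ be a complete separable metric space and $p\in[1,\infty]$. For any $(Z,p)$-networks $(X,\omega_X,\mu_X)$ and $(Y,\omega_Y,\mu_Y)$ there exists a coupling $\pi\in\mathcal{C}(\mu_X,\mu_Y)$ such that $$\mathrm{GW}_p^Z(X,Y)=\tfrac12\,\mathrm{dis}_p^Z(\pi).$$
   Context: A $(Z,p)$-network is a triple $(X,\omega_X,\mu_X)$ where $X$ is a Polish space, $\mu_X$ is a Borel probability measure on $X$, and $\omega_X:X\times X\to Z$ is measurable with $\|d_Z(\omega_X(\cdot,\cdot),z_0)\|_{L^p(\mu_X\otimes\mu_X)}<\infty$ for some (equivalently every) $z_0\in Z$. $\mathcal{C}(\mu_X,\mu_Y)$ is the set of probability measures on $X\times Y$ with marginals $\mu_X$ and $\mu_Y$. For $\pi\in\mathcal{C}(\mu_X,\mu_Y)$, $\mathrm{dis}_p^Z(\pi)$ is the $L^p(\pi\otimes\pi)$-norm of the function $(x,y,x',y')\mapsto d_Z(\omega_X(x,x'),\omega_Y(y,y'))$ on $(X\times Y)^2$ (essential supremum if $p=\infty$), and $\mathrm{GW}_p^Z(X,Y)=\frac12\inf_{\pi\in\mathcal{C}(\mu_X,\mu_Y)}\mathrm{dis}_p^Z(\pi)$. *)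

(* Defs.v *)
From HB Require Import structures.
From mathcomp Require Import all_boot all_order all_algebra.
From mathcomp Require Import all_classical all_reals all_analysis.

Set Implicit Arguments.
Unset Strict Implicit.
Unset Printing Implicit Defensive.

Import Order.TTheory GRing.Theory Num.Theory.
Import numFieldNormedType.Exports.

Local Open Scope classical_set_scope.
Local Open Scope ring_scope.

#[short(type="completeMetricType")]
HB.structure Definition CompleteMetric (R : numDomainType) :=
  {T of Metric R T & Complete T}.

Definition separable (T : topologicalType) : Prop :=
  exists2 D : set T, countable D & dense D.

(** No metric is fixed on [T]: [M] and the homeomorphism are only asserted to
    exist. *)
Definition polish (R : realType) (T : topologicalType) : Prop :=
  separable T /\
  exists (M : completeMetricType R) (f : T -> M) (g : M -> T),
    [/\ cancel f g, cancel g f, continuous f & continuous g].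

(** [borel T] is [T] with its Borel sigma-algebra; [(borel S * borel T)%type]
    then carries the product sigma-algebra, which is the Borel sigma-algebra of
    the product when [S] and [T] are separable metrizable. *)
Notation borel T := (g_sigma_algebraType (@open T)).

(** Spaces are pointed because [measurableType] is; no generality is lost, as
    the empty space carries no probability measure, so that the domain and the
    codomain of [omega] are nonempty. *)
Record network (R : realType) (Z : completeMetricType R) (p : \bar R) :=
  Network {
    space :> ptopologicalType;
    space_polish : polish R space;
    prob : probability (borel space) R;
    omega : space * space -> Z;
    omega_measurable :
      measurable_fun setT (omega : borel space * borel space -> borel Z);
    omega_finite : exists z0 : Z,
      (Lnorm (prob \x prob) p
         (fun q : borel space * borel space => (mdist (omega q) z0)%:E)
       < +oo)%E
  }.

Section GromovWasserstein.
Context (R : realType) (Z : completeMetricType R) (p : \bar R).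
Context (X Y : network Z p).

Definition coupling (pi : probability (borel X * borel Y)%type R) : Prop :=
  (forall A : set (borel X), measurable A -> pushforward pi fst A = prob X A) /\
  (forall B : set (borel Y), measurable B -> pushforward pi snd B = prob Y B).

(** The [Lnorm] at [p = +oo] is the essential supremum. *)
Definition dis (pi : probability (borel X * borel Y)%type R) : \bar R :=
  Lnorm (pi \x pi)%E p
    (fun q : (borel X * borel Y) * (borel X * borel Y) =>
       (mdist (omega (q.1.1, q.2.1)) (omega (q.1.2, q.2.2)))%:E).

Definition GW : \bar R :=
  ((2^-1)%:E * ereal_inf [set dis pi | pi in [set pi | coupling pi]])%E.

End GromovWasserstein.

(* Main.v *)
Require Import Defs.
From HB Require Import structures.
From mathcomp Require Import all_boot all_order all_algebra.
From mathcomp Require Import all_classical all_reals all_analysis.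
From mathcomp Require Import measurable_realfun ess_sup_inf.
From mathcomp Require Import lra.

(**
The proof is the direct method: take couplings whose distortions tend to the
infimum, extract a limit coupling, and show that the distortion does not jump
up in the limit.

Because the gauges [omega] are merely measurable, weak convergence of couplings
is not strong enough to pass to the limit. The convergence used instead is
setwise convergence on all measurable rectangles [A `*` B]; the fixed marginals
make it available. Limits are taken along an ultrafilter finer than [\oo], so
that every bounded real sequence converges and no subsequence is ever chosen.

Existence of the limit (lemma [coupling_compact]). A Polish space is a
measurable retract of the space [nat -> bool] of codes
([polish_code_retract]): record which balls of a countable family contain the
point, and conversely send a code to the point on which its balls close in, if
there is one. Thus X x Y is a measurable retract of the space of codes as well,
and it suffices to find limits of probabilities on codes ([codes_compact]).
There, the limits of the masses of the finite prefixes form a consistent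
family, and such a family is the law of a quantile function on [0, 1), which
reads off the nested intervals that contain its argument
([prefix_mass_extension]). A limit found on codes has the right marginals, and
the pi-lambda theorem, applied in one variable at a time, extends the
convergence from prefixes to all rectangles ([cvg_mass_rectangle]); the fixed
marginals control the tails of countable unions uniformly.

Lower semicontinuity (lemma [lsc_dis]). The pi-lambda argument, applied now to
the squares of the couplings, gives convergence on the sets
{C(x, x') and D(y, y')} for all measurable C and D. Since Z is separable, the
set where d(omega(x, x'), omega(y, y')) > a is a countable union of such sets
([mdist_gt_rectangles]), so its mass in the limit is at most the lower limit of
its masses. Slicing a nonnegative function into layers turns this property of
superlevel sets into lower semicontinuity of the Lp norm, and for p = +oo the
superlevel sets that stay null have a null limit ([lsc_Lnorm]).
*)

Set Implicit Arguments.
Unset Strict Implicit.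
Unset Printing Implicit Defensive.

Import Order.TTheory GRing.Theory Num.Theory.
Import numFieldNormedType.Exports.

Local Open Scope classical_set_scope.
Local Open Scope ring_scope.

(** * Limits along an ultrafilter *)

Lemma ultra_fmap (I T : Type) (f : I -> T) (F : set_system I) :
  UltraFilter F -> UltraFilter (f @ F).
Proof.
move=> UF; split => [|G FG sFG]; first exact: fmap_proper_filter.
apply/seteqP; split => // A GA.
have [//|FnA] := in_ultra_setVsetC (f @^-1` A) UF.
have GnA : G (~` A) by apply: sFG.
have /filter_ex[x [Ax nAx]] : G (A `&` ~` A) by exact: filterI.
by case: nAx.
Qed.

Lemma ultra_cvg_bounded (R : realType) (I : Type) (F : set_system I)
    (u : I -> R) (a b : R) : UltraFilter F -> (forall i, a <= u i <= b) ->
  exists2 l, a <= l <= b & u i @[i --> F] --> l.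
Proof.
move=> UF uab; have := @segment_compact R a b.
rewrite compact_ultra => /(_ (u @ F) (ultra_fmap u UF)) uF.
have [|l [lab ul]] := uF; first by apply: nearW => i /=; rewrite in_itv/=.
by exists l => //; move: lab; rewrite /= in_itv.
Qed.

(** * Masses of probability measures *)

(** Normalizing a measure of total mass 1 changes nothing, but yields an object
    whose type is that of probabilities. *)
Lemma probability_of_measure (R : realType) d (T : measurableType d)
    (mu : {measure set T -> \bar R}) : mu setT = 1%E ->
  exists P : probability T R, forall A, P A = mu A.
Proof.
move=> mu1; exists (mnormalize mu (\d_ (point : T))) => A.
rewrite /= /mnormalize mu1; case: ifPn => [|_]; first by rewrite onee_eq0.
by rewrite invr1 mule1.
Qed.

Lemma probability_push (R : realType) d d' (T : measurableType d)
    (T' : measurableType d') (P : probability T R) (f : T -> T') :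
  measurable_fun setT f ->
  exists Q : probability T' R, forall A, Q A = P (f @^-1` A).
Proof.
move=> mf; pose h : {mfun T >-> T'} := mfun_Sub (mem_set mf).
by exists (distribution P h) => A.
Qed.

(** Masses as real numbers, for which subtraction and the limit theorems carry
    no finiteness side conditions. *)
Definition mass (R : realType) d (T : measurableType d) (P : probability T R)
  (A : set T) : R := fine (P A).

Section mass.
Context (R : realType) d (T : measurableType d) (P : probability T R).
Implicit Types A B : set T.

Lemma massE A : measurable A -> P A = (mass P A)%:E.
Proof. by move=> mA; rewrite fineK// fin_num_measure. Qed.

Lemma mass_ge0 A : 0 <= mass P A.
Proof. exact: fine_ge0. Qed.

Lemma mass_le1 A : measurable A -> mass P A <= 1.
Proof. by move=> mA; rewrite -lee_fin -massE// probability_le1. Qed.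

Lemma massT : mass P setT = 1.
Proof. by rewrite /mass probability_setT. Qed.

Lemma mass0 : mass P set0 = 0.
Proof. by rewrite /mass measure0. Qed.

Lemma massU A B : measurable A -> measurable B -> A `&` B = set0 ->
  mass P (A `|` B) = mass P A + mass P B.
Proof.
by move=> mA mB AB0; rewrite /mass measureU// fineD// fin_num_measure.
Qed.

Lemma massDI A B : measurable A -> measurable B ->
  mass P A = mass P (A `\` B) + mass P (A `&` B).
Proof.
move=> mA mB; rewrite -massU ?setDUK//.
- by rewrite setUC setUIDK.
- exact: measurableD.
- exact: measurableI.
- by rewrite setDE setIACA setICl setI0.
Qed.

Lemma massUI A B : measurable A -> measurable B ->
  mass P (A `|` B) = mass P A + mass P B - mass P (A `&` B).
Proof.
move=> mA mB; have -> : A `|` B = (A `\` B) `|` B.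
  by apply/seteqP; split => x /=; have := pselect (B x); tauto.
rewrite massU//; first by rewrite (massDI mA mB); lra.
  exact: measurableD.
by rewrite setDE -setIA setICl setI0.
Qed.

Lemma le_mass A B : measurable A -> measurable B -> A `<=` B ->
  mass P A <= mass P B.
Proof.
by move=> mA mB AB; rewrite -lee_fin -!massE// le_measure// inE.
Qed.

End mass.

Lemma cvg_mass_bigcup (R : realType) d (T : measurableType d)
    (P : probability T R) (E : (set T)^nat) : (forall n, measurable (E n)) ->
  mass P (\big[setU/set0]_(k < n) E k) @[n --> \oo] --> mass P (\bigcup_k E k).
Proof.
move=> mE.
have -> : \bigcup_k E k = \bigcup_n \big[setU/set0]_(k < n) E k.
  apply/seteqP; split => [x [k _ Ekx]|]; last first.
    by move=> x [n _ Unx]; exact: bigsetU_bigcup Unx.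
  by exists k.+1 => //; rewrite big_ord_recr; right.
have mU n : measurable (\big[setU/set0]_(k < n) E k) by exact: bigsetU_measurable.
apply: fine_cvg; rewrite -massE; last exact: bigcupT_measurable.
apply: nondecreasing_cvg_mu => //; first exact: bigcupT_measurable.
by move=> n k nk; apply/subsetPset; exact: subset_bigsetU.
Qed.

(** * The space of codes *)

(** These sets form a pi-system, unlike the prefix sets below, and the preimage
    of one of them under the extraction of the even (or odd) digits is again one
    of them. *)
Definition ones (s : seq nat) : set (nat -> bool) := [set c | all c s].

Notation codes := (g_sigma_algebraType (range ones)).

Lemma ones_nil : ones [::] = setT.
Proof. exact/seteqP. Qed.

Lemma onesI s t : ones s `&` ones t = ones (s ++ t).
Proof. by apply/seteqP; split => c; rewrite /ones/= all_cat => /andP. Qed.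

Lemma measurable_ones s : measurable (ones s : set codes).
Proof. by apply: sub_sigma_algebra; exists s. Qed.

Lemma setI_closed_ones : setI_closed (range ones).
Proof. by move=> _ _ [s _ <-] [t _ <-]; rewrite onesI; exists (s ++ t). Qed.

Lemma measurable_digit i : measurable [set c : codes | c i].
Proof.
rewrite [X in measurable X](_ : _ = ones [:: i]); first exact: measurable_ones.
by apply/seteqP; split => c; rewrite /ones/= andbT.
Qed.

Lemma measurable_to_code d (T : measurableType d) (f : T -> nat -> bool) :
  (forall k, measurable [set x | f x k]) ->
  measurable_fun setT (f : T -> codes).
Proof.
move=> mf; apply: (@measurability _ _ T codes setT f (range ones)) => //.
move=> _ [_ [s _ <-] <-]; rewrite setTI.
elim: s => [|k s IHs]; first by rewrite ones_nil preimage_setT.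
rewrite -[k :: s]/([:: k] ++ s) -onesI preimage_setI.
apply: measurableI => //.
by rewrite [X in measurable X](_ : _ = [set x | f x k])//;
  apply/seteqP; split => x; rewrite /ones/= andbT.
Qed.

(** The codes that start with [rev v]: words are stored with their last digit at
    the head, so that appending a digit is a [cons]. *)
Fixpoint prefix_set (v : seq bool) : set codes :=
  if v is b :: v' then prefix_set v' `&` [set c | c (size v') = b] else setT.

Lemma measurable_prefix v : measurable (prefix_set v).
Proof.
elim: v => //= b v IHv; apply: measurableI => //.
have m1 : measurable [set c : codes | c (size v) = true].
  rewrite [X in measurable X](_ : _ = ones [:: size v]).
    exact: measurable_ones.
  by apply/seteqP; split => c; rewrite /ones/= andbT.
case: b => //; rewrite [X in measurable X](_ : _ =
  ~` [set c : codes | c (size v) = true]); first exact: measurableC.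
by apply/seteqP; split => c /=; case: (c _).
Qed.

Lemma prefix_split v : prefix_set v =
  prefix_set (false :: v) `|` prefix_set (true :: v).
Proof.
apply/seteqP; split => c /=; last by move=> [[]|[]].
by move=> cv; case: (c (size v)); [right|left].
Qed.

Lemma prefix_disj v : prefix_set (false :: v) `&` prefix_set (true :: v) = set0.
Proof. by apply/seteqP; split => c //= [[_ ->] []]. Qed.

(** A prefix decides every digit below its length, hence decides [ones s] as soon
    as it is longer than every index in [s]. *)
Lemma prefix_ones s v : (forall k, k \in s -> (k < size v)%N) ->
  prefix_set v `<=` ones s \/ prefix_set v `&` ones s = set0.
Proof.
move=> sv; pose w k := nth false (rev v) k.
have pw c : prefix_set v c -> forall k, (k < size v)%N -> c k = w k.
  rewrite {}/w {sv}; elim: v => // b v IHv [/IHv{}IHv /= cb] k.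
  rewrite rev_cons nth_rcons size_rev ltnS leq_eqVlt => /predU1P[->|kv].
    by rewrite ltnn eqxx.
  by rewrite kv IHv.
have [sw|/allPn[k ks wk]] := boolP (all w s); [left|right].
  by move=> c /pw cw; apply/allP => k ks; rewrite cw ?sv//; exact: (allP sw).
apply/seteqP; split => // c [/pw cw /allP/(_ _ ks)].
by rewrite cw ?sv// (negbTE wk).
Qed.

(** * A consistent family of prefix masses is a probability *)

Section quantile.
Context (R : realType) (m : seq bool -> R).
Hypothesis m_ge0 : forall v, 0 <= m v.
Hypothesis m_nil : m [::] = 1.
Hypothesis m_split : forall v, m v = m (false :: v) + m (true :: v).

(** The word [v] is assigned the interval [left_end v, left_end v + m v); the
    interval of [v] is cut into that of [false :: v] followed by that of
    [true :: v]. *)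
Fixpoint left_end (v : seq bool) : R :=
  if v is b :: v' then left_end v' + (if b then m (false :: v') else 0) else 0.

Fixpoint digits (t : R) (n : nat) : seq bool :=
  if n is n'.+1 then
    let v := digits t n' in (left_end v + m (false :: v) <= t) :: v
  else [::].

Definition quantile (t : R) (k : nat) : bool := head false (digits t k.+1).

Lemma size_digits t n : size (digits t n) = n.
Proof. by elim: n => //= n ->. Qed.

(** The intervals of the words of a given length partition [0, 1), and
    [digits t n] is the word of length [n] whose interval contains [t]. *)
Lemma digitsP t v : 0 <= t < 1 ->
  (digits t (size v) == v) = (left_end v <= t < left_end v + m v).
Proof.
move=> t01; elim: v => [|b v IHv] /=; first by rewrite eqxx m_nil add0r t01.
rewrite eqseq_cons; have [dv|dv] := eqVneq (digits t (size v)) v.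
  rewrite dv andbT; rewrite dv eqxx in IHv; move/esym/andP: IHv => [v1 v2].
  have mv := m_split v.
  case: b; apply/eqP/andP.
  - by move=> h; split; lra.
  - by case.
  - by move/negbT; rewrite -ltNge => h; split; lra.
  - by move=> [_ h]; apply/negbTE; rewrite -ltNge; lra.
rewrite andbF; apply/esym/negbTE; apply/negP => /andP[w1 w2].
move: IHv; rewrite (negbTE dv) => /esym/negP; apply.
have mv := m_split v; have mv0 := m_ge0 (false :: v).
have mv1 := m_ge0 (true :: v).
by case: b w1 w2 => w1 w2; apply/andP; split; lra.
Qed.

Lemma prefix_quantile t v : prefix_set v (quantile t) <-> digits t (size v) = v.
Proof.
elim: v => //= b v IHv; rewrite /quantile/=.
split => [[/IHv dv vb]|[vb dv]]; first by rewrite vb dv.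
by split => //; exact/IHv.
Qed.

Lemma quantile_preimage v : `[0, 1[%classic `&` quantile @^-1` prefix_set v =
  `[left_end v, left_end v + m v[%classic.
Proof.
have lv : 0 <= left_end v /\ left_end v + m v <= 1.
  elim: v => [|b v [IH1 IH2]] /=; first by rewrite add0r m_nil.
  have mv := m_split v; have mv0 := m_ge0 (false :: v).
  have mv1 := m_ge0 (true :: v).
  by case: b; split; lra.
apply/seteqP; split => t /=; rewrite !in_itv/=.
  by move=> [t01 /prefix_quantile/eqP]; rewrite digitsP.
move=> tv; have t01 : 0 <= t < 1 by lra.
by split => //; apply/prefix_quantile/eqP; rewrite digitsP.
Qed.

Lemma measurable_digits v : measurable [set t | digits t (size v) = v].
Proof.
elim: v => [|b v IHv] /=.
  by rewrite [X in measurable X](_ : _ = setT)//; exact/seteqP.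
rewrite [X in measurable X](_ : _ = [set t | digits t (size v) = v] `&`
    (if b then `[left_end v + m (false :: v), +oo[
          else `]-oo, left_end v + m (false :: v)[)%classic); last first.
  apply/seteqP; split => t /=.
    move=> [bE dv]; split => //; rewrite dv in bE.
    by case: b bE => /= bE; rewrite in_itv/= ?andbT ?bE// ltNge bE.
  by move=> [dv]; rewrite dv; case: b; rewrite /= in_itv/= ?andbT;
    [move=> -> | rewrite ltNge => /negbTE ->].
by apply: measurableI => //; case: b; exact: measurable_itv.
Qed.

Lemma measurable_quantile : measurable_fun setT (quantile : R -> codes).
Proof.
apply: measurable_to_code => k.
rewrite [X in measurable X](_ : _ = \bigcup_(v in [set: seq bool])
  ([set t | digits t (size (true :: v)) = true :: v] `&`
   [set t | size v = k])).
  apply: countable_bigcupT_measurable => // v; apply: measurableI.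
    exact: measurable_digits.
  have [->|vk] := eqVneq (size v) k.
    by rewrite [X in measurable X](_ : _ = setT)//; exact/seteqP.
  rewrite [X in measurable X](_ : _ = set0)//.
  by apply/seteqP; split => t //= /eqP; rewrite (negbTE vk).
apply/seteqP; split => t; rewrite /quantile.
  move=> /= dk; exists (digits t k) => //; split; last by rewrite /= size_digits.
  by move: dk; rewrite /= size_digits => ->.
by move=> [v _ [/= + vk]]; rewrite vk => -[-> _].
Qed.

(** The law of [quantile] under the Lebesgue measure of [0, 1) does the job, as
    the preimage of a prefix set is an interval of the prescribed length. *)
Lemma prefix_mass_extension : exists P : probability codes R,
  forall v, P (prefix_set v) = (m v)%:E.
Proof.
have leb1 : mrestr (@lebesgue_measure R) (measurable_itv `[(0:R), 1[) setT = 1%E.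
  by rewrite /mrestr setTI lebesgue_measure_itv/= lte_fin ltr01 oppr0 adde0.
have [L LE] := probability_of_measure leb1.
have [P PE] := probability_push L measurable_quantile.
exists P => v; rewrite PE LE /= /mrestr setIC quantile_preimage.
rewrite lebesgue_measure_itv/= lte_fin ltrDl.
have [->|mv] := eqVneq (m v) 0; first by rewrite ltxx.
by rewrite lt_neqAle eq_sym mv m_ge0/= -EFinB addrAC subrr add0r.
Qed.

End quantile.

(** * Compactness of the probabilities on codes *)

Section codes_compact.
Context (R : realType) (I : Type) (F : set_system I).
Context (P_ : I -> probability codes R).

(** [ones s] is the finite disjoint union of the prefix sets of a large enough
    length [n] that it contains. The induction goes down from words of length
    [n] to the empty word, splitting a word into its two extensions. *)
Lemma cvg_mass_ones_of_prefix (P : probability codes R) : ProperFilter F ->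
  (forall v, mass (P_ i) (prefix_set v) @[i --> F] --> mass P (prefix_set v)) ->
  forall s, mass (P_ i) (ones s) @[i --> F] --> mass P (ones s).
Proof.
move=> FF Pv s; pose n := (\max_(k <- s) k).+1.
have sn k : k \in s -> (k < n)%N.
  by move=> ks; rewrite /n ltnS (big_rem k)//= leq_maxl.
pose cvg_at v := mass (P_ i) (prefix_set v `&` ones s) @[i --> F] -->
  mass P (prefix_set v `&` ones s).
suff H j v : (j + size v)%N = n -> cvg_at v.
  by have := H n [::] (addn0 n); rewrite /cvg_at/= setTI.
elim: j v => [|j IHj] v jn; rewrite /cvg_at.
  have sv k : k \in s -> (k < size v)%N by move=> /sn; rewrite -jn.
  have [vs|->] := prefix_ones sv; first by rewrite setIidl//; exact: Pv.
  by rewrite mass0; under eq_fun do rewrite mass0; exact: cvg_cst.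
have mv b : measurable (prefix_set (b :: v) `&` ones s).
  by apply: measurableI; [exact: measurable_prefix|exact: measurable_ones].
have split_mass (Q : probability codes R) : mass Q (prefix_set v `&` ones s) =
    mass Q (prefix_set (false :: v) `&` ones s) +
    mass Q (prefix_set (true :: v) `&` ones s).
  rewrite prefix_split setIUl massU//.
  by rewrite setIACA prefix_disj set0I.
rewrite split_mass; under eq_fun do rewrite split_mass.
by apply: cvgD; apply: IHj => /=; rewrite addnS -addSn.
Qed.

(** The limits of the masses of prefixes inherit additivity, which on codes is all
    that is needed to be the masses of a probability. *)
Lemma codes_compact : UltraFilter F ->
  exists P : probability codes R,
    forall s, mass (P_ i) (ones s) @[i --> F] --> mass P (ones s).
Proof.
move=> UF.
have /choice[m mP] v : exists l : R, 0 <= l <= 1 /\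
    mass (P_ i) (prefix_set v) @[i --> F] --> l.
  have m01 i : 0 <= mass (P_ i) (prefix_set v) <= 1.
    by rewrite mass_ge0 mass_le1//; exact: measurable_prefix.
  by have [l l01 cl] := ultra_cvg_bounded UF m01; exists l.
have m_nil : m [::] = 1.
  have := (mP [::]).2 => /=; under eq_fun do rewrite massT.
  by move=> h; apply: (cvg_unique _ h); [exact: Rhausdorff|exact: cvg_cst].
have m_split v : m v = m (false :: v) + m (true :: v).
  apply: (cvg_unique _ (mP v).2); first exact: Rhausdorff.
  have split_mass (Q : probability codes R) : mass Q (prefix_set v) =
      mass Q (prefix_set (false :: v)) + mass Q (prefix_set (true :: v)).
    by rewrite {1}prefix_split massU//;
      [exact: measurable_prefix|exact: measurable_prefix|exact: prefix_disj].
  rewrite /=; under eq_fun do rewrite split_mass.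
  by apply: cvgD; [exact: (mP _).2|exact: (mP _).2].
have [P PE] := prefix_mass_extension (fun v => proj1 (andP (mP v).1)) m_nil m_split.
exists P; apply: cvg_mass_ones_of_prefix => v.
by rewrite {2}/mass PE; exact: (mP v).2.
Qed.

End codes_compact.

(** * Polish spaces as retracts of the space of codes *)

Definition recip {R : realType} (k : nat) : R := k.+1%:R^-1.

Lemma recip_gt0 (R : realType) k : 0 < recip k :> R.
Proof. by rewrite invr_gt0. Qed.

Lemma recip_lt_ex (R : realType) (e : R) : 0 < e -> exists k, recip k < e.
Proof. by move=> /ltr_add_invr[k]; rewrite add0r; exists k. Qed.

Lemma near_recip_lt (R : realType) (e : R) : 0 < e -> \forall k \near \oo, recip k < e.
Proof. by move=> e0; exact: near_infty_natSinv_lt (PosNum e0). Qed.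

Lemma dense_sequence (T : ptopologicalType) : separable T ->
  exists d : nat -> T, forall U : set T, open U -> U !=set0 -> exists j, U (d j).
Proof.
move=> [D /countable_injP[h hinj] dD].
exists (fun j => xget point (D `&` [set x | h x = j])) => U oU U0.
have [x [Ux Dx]] := dD U U0 oU; exists (h x).
have [Dy hy] : (D `&` [set y | h y = h x]) (xget point (D `&` [set y | h y = h x])).
  by apply: (xgetPex point); exists x.
by rewrite (hinj _ _ _ _ hy)// inE.
Qed.

Lemma open_mdist_ball (R : realType) (M : metricType R) (x : M) (e : R) :
  open [set y | mdist y x < e].
Proof.
rewrite openE => y /= yx; rewrite /interior -nbhs_ballE.
exists (e - mdist y x) => /=; first by rewrite subr_gt0.
rewrite ballEmdist => z /= yz; have := metric_triangle z y x.
by rewrite (metric_sym z y); lra.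
Qed.

(** The ball of index [i] in a countable family has center [center i] and radius
    [radius i]; the family contains all balls centered in the dense sequence [d]
    with radius [recip k]. *)
Section metric_code.
Context (R : realType) (M : completeMetricType R) (d : nat -> M).
Hypothesis d_dense : forall (x : M) (e : R), 0 < e -> exists j, mdist x (d j) < e.

Let idx (i : nat) : nat * nat := odflt (0, 0)%N (unpickle i).
Let center i := d (idx i).2.
Let radius i : R := recip (idx i).1.

Definition metric_code (x : M) (i : nat) : bool := mdist x (center i) < radius i.

(** The codes whose balls are arbitrarily small and pairwise close: in a complete
    space, exactly these close in on a point. Only countably many digits are
    constrained, so the set is measurable. *)
Definition cauchy_codes : set codes := [set c |
  (forall k, exists2 i, radius i <= recip k & c i) /\
  (forall i i', c i -> c i' -> mdist (center i) (center i') <= radius i + radius i')].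

Lemma metric_code_small x (e : R) : 0 < e ->
  exists2 i, radius i < e & metric_code x i.
Proof.
move=> /recip_lt_ex[k ke].
have [j xj] : exists j, mdist x (d j) < recip k by exact: d_dense (recip_gt0 _ _).
by exists (pickle (k, j)); rewrite /metric_code /radius /center /idx pickleK.
Qed.

Lemma metric_code_cauchy x : cauchy_codes (metric_code x).
Proof.
split => [k|i i'].
  have [i ik xi] := metric_code_small x (recip_gt0 R k).
  by exists i => //; exact: ltW.
rewrite /metric_code => xi xi'; have := metric_triangle (center i) x (center i').
by rewrite (metric_sym (center i) x); lra.
Qed.

Lemma cauchy_codes_lim c : cauchy_codes c ->
  exists x : M, forall i, c i -> mdist (center i) x <= radius i.
Proof.
move=> [csmall ccauchy].
have /choice[i_ iP] k : exists i, radius i <= recip k /\ c i.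
  by have [i] := csmall k; exists i.
pose u k := center (i_ k).
have /cvg_ex[x ux] : cvg (u @ \oo).
  apply: cauchy_cvg; apply: cauchy_exP => e e0.
  have [k ke] := recip_lt_ex (divr_gt0 e0 (@ltr0Sn R 1)).
  exists (u k).
  change (\forall l \near \oo, ball (u k) e (u l)); near=> l.
  have ul : mdist (u k) (u l) <= radius (i_ k) + radius (i_ l).
    by apply: ccauchy; [exact: (iP k).2|exact: (iP l).2].
  have lk : recip l < e / 2 by near: l; exact: near_recip_lt (divr_gt0 e0 (@ltr0Sn R 1)).
  rewrite ballEmdist /=; apply: (le_lt_trans ul).
  by have := (iP k).1; have := (iP l).1; lra.
exists x => i ci; apply/ler_addgt0Pr => e e0.
near \oo => l.
have ul : mdist (center i) (u l) <= radius i + radius (i_ l).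
  by apply: ccauchy => //; exact: (iP l).2.
have xl : mdist x (u l) < e / 2.
  suff : ball x (e / 2) (u l) by rewrite ballEmdist.
  by near: l; exact: cvg_ball ux _ (divr_gt0 e0 (@ltr0Sn R 1)).
have rl : recip l < e / 2.
  by near: l; exact: near_recip_lt (divr_gt0 e0 (@ltr0Sn R 1)).
have := (iP l).1; have := metric_triangle (center i) (u l) x.
by rewrite (metric_sym (u l) x); lra.
Unshelve. all: by end_near. Qed.

Lemma measurable_cauchy_codes : measurable cauchy_codes.
Proof.
have -> : cauchy_codes =
    (\bigcap_k \bigcup_(i in [set i | radius i <= recip k]) [set c : codes | c i]) `&`
    (\bigcap_i \bigcap_(i' in
        [set i' | ~~ (mdist (center i) (center i') <= radius i + radius i')])
      ~` ([set c : codes | c i] `&` [set c | c i'])).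
  apply/seteqP; split => c [c1 c2]; split.
  - by move=> k _; have [i ik ci] := c1 k; exists i.
  - by move=> i _ i' /= /negP ii' [ci ci']; apply: ii'; exact: c2.
  - by move=> k; have [i ik ci] := c1 k I; exists i.
  - move=> i i' ci ci'; apply/negPn/negP => ii'.
    by apply: (c2 i I i' ii').
have mC i i' : measurable (~` ([set c : codes | c i] `&` [set c | c i'])).
  by apply: measurableC; apply: measurableI; exact: measurable_digit.
apply: measurableI; apply: bigcapT_measurable => k.
  by apply: bigcup_measurable => i _; exact: measurable_digit.
have [->|/set0P N0] := eqVneq
  [set i' | ~~ (mdist (center k) (center i') <= radius k + radius i')] set0.
  by rewrite bigcap_set0.
by apply: bigcap_measurable => // i' _.
Qed.

(** Outside of [cauchy_codes] the retraction is constant. On [cauchy_codes], the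
    limit point lies in an open set [U] if and only if some ball of the code has
    its closed ball inside [U], which is a countable union of conditions on
    digits. *)
Lemma metric_code_retract : exists rho : codes -> borel M,
  measurable_fun setT rho /\ cancel metric_code rho.
Proof.
have /choice[rho rhoP] (c : codes) : exists x : M,
    (cauchy_codes c -> forall i, c i -> mdist (center i) x <= radius i) /\
    (~ cauchy_codes c -> x = point).
  have [cc|cc] := pselect (cauchy_codes c).
    by have [x xP] := cauchy_codes_lim cc; exists x.
  by exists point.
exists rho; split; last first.
  move=> x; apply: mdist_positivity; apply/eqP; rewrite eq_le mdist_ge0 andbT.
  apply/ler_addgt0Pr => e e0; rewrite add0r.
  have [i ie xi] := metric_code_small x (divr_gt0 e0 (@ltr0Sn R 1)).
  have ri := (rhoP (metric_code x)).1 (metric_code_cauchy x) i xi.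
  rewrite metric_sym; apply: (le_trans (metric_triangle _ (center i) _)).
  by apply: (le_trans (lerD (ltW xi) ri)); lra.
apply: (@measurability _ _ codes (borel M) setT rho (@open M)) => //.
move=> _ [U oU <-]; rewrite setTI.
pose B := [set i | forall y, mdist (center i) y <= radius i -> U y].
have -> : rho @^-1` U =
    (cauchy_codes `&` \bigcup_(i in B) [set c : codes | c i]) `|`
    (~` cauchy_codes `&` [set c | U point]).
  apply/seteqP; split => c /=.
    have [cc|cc] := pselect (cauchy_codes c); last first.
      by rewrite ((rhoP c).2 cc) => Up; right.
    move=> Urc; left; split => //.
    have /nbhs_ballP[e /= e0 eU] : nbhs (rho c) U by exact: open_nbhs_nbhs.
    have [k ke] := recip_lt_ex (divr_gt0 e0 (@ltr0Sn R 1)).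
    have [i ik ci] := cc.1 k; exists i => //= y iy; apply: eU.
    rewrite ballEmdist/=; have := metric_triangle (rho c) (center i) y.
    by have := (rhoP c).1 cc i ci; rewrite (metric_sym (rho c) (center i)); lra.
  by move=> [[cc [i /= iB ci]]|[cc Up]];
    [apply: iB; exact: (rhoP c).1|rewrite ((rhoP c).2 cc)].
apply: measurableU.
  apply: measurableI; first exact: measurable_cauchy_codes.
  by apply: bigcup_measurable => i _; exact: measurable_digit.
apply: measurableI; first exact: measurableC measurable_cauchy_codes.
have [Up|Up] := pselect (U point).
  by have -> : [set c : codes | U point] = setT by apply/seteqP; split.
by have -> : [set c : codes | U point] = set0 by apply/seteqP; split.
Qed.

End metric_code.

Lemma polish_code_retract (R : realType) (T : ptopologicalType) : polish R T ->
  exists (c : borel T -> codes) (rho : codes -> borel T),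
    [/\ measurable_fun setT c, measurable_fun setT rho & cancel c rho].
Proof.
move=> [/dense_sequence[d dd] [M [f [g [fK gK cf cg]]]]].
have d_dense (x : M) (e : R) : 0 < e -> exists j, mdist x (f (d j)) < e.
  move=> e0; have [||j fj] := dd (f @^-1` [set y | mdist y x < e]).
  - by apply: open_comp => [? _|]; [exact: cf|exact: open_mdist_ball].
  - by exists (g x); rewrite /= gK mdistxx.
  - by exists j; rewrite metric_sym.
have [rho [mrho rhoK]] := metric_code_retract d_dense.
exists (metric_code (f \o d) \o f), (g \o rho); split.
- apply: measurable_to_code => k; apply: sub_sigma_algebra.
  apply: (@open_comp _ _ f [set y | mdist y _ < _]) => [? _|]; first exact: cf.
  exact: open_mdist_ball.
- apply: (measurableT_comp (f := (g : borel M -> borel T))) => //.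
  apply: (@measurability _ _ (borel M) (borel T) setT g (@open T)) => //.
  move=> _ [U oU <-]; rewrite setTI; apply: sub_sigma_algebra.
  by apply: open_comp => // ? _; exact: cg.
- by move=> x; rewrite /= rhoK fK.
Qed.

(** * Convergence on rectangles *)

Section pi_lambda.
Context (R : realType) (I : Type) (F : set_system I) {FF : ProperFilter F}.
Context d (O : measurableType d) (P_ : I -> probability O R).
Context (P : probability O R).

(** The class of good sets [A] is a lambda-system. The only delicate point is a
    countable disjoint union: the part of it beyond index [n] has, under every
    [P_ i] and under [P], the same mass, which is small for [n] large. *)
Lemma cvg_mass_pi_lambda d' (S : measurableType d') (f : O -> S)
    (G : set (set S)) (D : set O) :
  measurable_fun setT f -> measurable D ->
  (forall i A, measurable A -> mass (P_ i) (f @^-1` A) = mass P (f @^-1` A)) ->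
  @measurable _ S = <<s G >> -> setI_closed G -> G setT ->
  (forall A, G A ->
     mass (P_ i) (f @^-1` A `&` D) @[i --> F] --> mass P (f @^-1` A `&` D)) ->
  forall A, measurable A ->
     mass (P_ i) (f @^-1` A `&` D) @[i --> F] --> mass P (f @^-1` A `&` D).
Proof.
move=> mf mD margE GE GI GT cvgG.
have mpre A : measurable A -> measurable (f @^-1` A).
  by move=> mA; rewrite -[X in measurable X]setTI; exact: mf.
have cvgT : mass (P_ i) D @[i --> F] --> mass P D.
  by have := cvgG _ GT; rewrite preimage_setT setTI.
rewrite GE; apply: (dynkin_induction (G := G)) => //.
- by rewrite preimage_setT setTI.
- move=> A mA cA; have massCI (Q : probability O R) :
      mass Q (f @^-1` (~` A) `&` D) = mass Q D - mass Q (f @^-1` A `&` D).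
    rewrite (massDI Q mD (mpre _ mA)) preimage_setC setIC -setDE.
    by rewrite (setIC D) addrK.
  by rewrite massCI; under eq_fun do rewrite massCI; exact: cvgB.
move=> E mE tE cE.
pose U n := \big[setU/set0]_(k < n) E k.
have mU n : measurable (U n) by exact: bigsetU_measurable.
have mUE : measurable (\bigcup_k E k) by exact: bigcupT_measurable.
have UE n : U n `<=` \bigcup_k E k by exact: bigsetU_bigcup.
have cU n :
    mass (P_ i) (f @^-1` U n `&` D) @[i --> F] --> mass P (f @^-1` U n `&` D).
  elim: n => [|n IHn].
    rewrite /U big_ord0 preimage_set0 set0I mass0.
    by under eq_fun do rewrite mass0; exact: cvg_cst.
  have massS (Q : probability O R) : mass Q (f @^-1` U n.+1 `&` D) =
      mass Q (f @^-1` U n `&` D) + mass Q (f @^-1` E n `&` D).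
    rewrite /U big_ord_recr preimage_setU setIUl massU//.
    - by apply: measurableI => //; exact/mpre/mU.
    - by apply: measurableI => //; exact/mpre.
    - rewrite setIACA -preimage_setI (_ : _ `&` E n = set0) ?preimage_set0 ?set0I//.
      apply/seteqP; split => x //= [Ux Ex].
      move: Ux; rewrite -bigcup_mkord => -[k /= kn Ekx].
      have := tE n k Logic.I Logic.I => /(_ (ex_intro _ x (conj Ex Ekx))) nk.
      by rewrite nk ltnn in kn.
  by rewrite massS; under eq_fun do rewrite massS; exact: cvgD.
(* [V n] is the tail of the union beyond index [n]. *)
pose V n := (\bigcup_k E k) `\` U n.
have mV n : measurable (V n) by exact: measurableD.
have massV (Q : probability O R) n : mass Q (f @^-1` (\bigcup_k E k) `&` D) =
    mass Q (f @^-1` U n `&` D) + mass Q (f @^-1` V n `&` D).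
  rewrite -massU//.
  - by rewrite -setIUl -preimage_setU /V setDUK.
  - by apply: measurableI => //; exact/mpre.
  - by apply: measurableI => //; exact/mpre.
  - by apply/seteqP; split => x //= [[Ux _] [[_ nUx] _]].
have cV : mass P (f @^-1` V n) @[n --> \oo] --> 0.
  have massVE n : mass P (f @^-1` V n) =
      mass P (f @^-1` \bigcup_k E k) - mass P (f @^-1` U n).
    rewrite (massDI P (mpre _ mUE) (mpre _ (mU n))).
    rewrite -preimage_setI (setIidr (UE n)) addrK.
    by rewrite /V !setDE preimage_setI preimage_setC.
  under eq_fun do rewrite massVE.
  rewrite -(subrr (mass P (f @^-1` \bigcup_k E k))).
  apply: cvgB; first exact: cvg_cst.
  rewrite preimage_bigcup /U; under eq_fun do
    rewrite (big_morph _ (@preimage_setU _ _ f) (@preimage_set0 _ _ f)).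
  by apply: cvg_mass_bigcup => n; exact: mpre.
apply/cvgrPdist_lt => e e0.
have e2 : 0 < e / 2 by rewrite divr_gt0.
have [n Vn] : exists n, mass P (f @^-1` V n) < e / 2.
  near \oo => n; exists n; near: n.
  have /cvgrPdist_lt/(_ _ e2) := cV; apply: filterS => n.
  by rewrite sub0r normrN ger0_norm// mass_ge0.
have /cvgrPdist_lt/(_ _ e2) := cU n; apply: filterS => i.
have tail (Q : probability O R) : mass Q (f @^-1` V n) = mass P (f @^-1` V n) ->
    0 <= mass Q (f @^-1` V n `&` D) < e / 2.
  move=> QV; rewrite mass_ge0/=; apply: le_lt_trans Vn; rewrite -QV.
  by apply: le_mass => //; [apply: measurableI => //; exact: mpre|exact: mpre].
have := tail _ (margE i _ (mV n)); have := tail P erefl.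
rewrite !(massV _ n) !ltr_norml; set a := mass P _; set b := mass P _.
set a' := mass _ _; set b' := mass _ _.
by move=> /andP[? ?] /andP[? ?] /andP[? ?]; apply/andP; split; lra.
Unshelve. all: by end_near. Qed.

(** First [A] varies with [B] in its pi-system, then [B] varies with [A]
    arbitrary. *)
Lemma cvg_mass_rectangle d1 d2 (S : measurableType d1) (T : measurableType d2)
    (f : O -> S) (g : O -> T) (G : set (set S)) (H : set (set T)) :
  measurable_fun setT f -> measurable_fun setT g ->
  (forall i A, measurable A -> mass (P_ i) (f @^-1` A) = mass P (f @^-1` A)) ->
  (forall i B, measurable B -> mass (P_ i) (g @^-1` B) = mass P (g @^-1` B)) ->
  @measurable _ S = <<s G >> -> setI_closed G -> G setT ->
  @measurable _ T = <<s H >> -> setI_closed H -> H setT ->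
  (forall A B, G A -> H B -> mass (P_ i) (f @^-1` A `&` g @^-1` B) @[i --> F]
     --> mass P (f @^-1` A `&` g @^-1` B)) ->
  forall A B, measurable A -> measurable B ->
    mass (P_ i) (f @^-1` A `&` g @^-1` B) @[i --> F]
     --> mass P (f @^-1` A `&` g @^-1` B).
Proof.
move=> mf mg fE gE GE GI GT HE HI HT cGH A B mA mB.
have comm A' B' : (mass (P_ i) (f @^-1` A' `&` g @^-1` B') @[i --> F]
     --> mass P (f @^-1` A' `&` g @^-1` B')) =
   (mass (P_ i) (g @^-1` B' `&` f @^-1` A') @[i --> F]
     --> mass P (g @^-1` B' `&` f @^-1` A')).
  by rewrite setIC; congr (_ @ F --> _); apply/funext => i; rewrite setIC.
rewrite comm.
have mpre d' (U : measurableType d') (h : O -> U) E : measurable_fun setT h ->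
    measurable E -> measurable (h @^-1` E).
  by move=> mh mE; rewrite -[X in measurable X]setTI; exact: mh.
apply: (@cvg_mass_pi_lambda _ T g H (f @^-1` A)) => // [|B' HB']; first exact: mpre.
rewrite -comm.
apply: (@cvg_mass_pi_lambda _ S f G (g @^-1` B')) => // [|A' GA']; last exact: cGH.
by apply: mpre => //; rewrite HE; exact: sub_gen_smallest.
Qed.

End pi_lambda.

(** * Compactness of couplings *)

Lemma probability_codes_unique (R : realType) (P Q : probability codes R) :
  (forall s, mass P (ones s) = mass Q (ones s)) ->
  forall A, measurable A -> P A = Q A.
Proof.
move=> PQ A mA.
apply: (@measure_unique _ R codes (range ones) (fun=> setT) _ _ _ _ P Q) => //.
- exact: setI_closed_ones.
- by move=> _; exists [::] => //; rewrite ones_nil.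
- by rewrite bigcup_const.
- move=> _ [s _ <-]; have ms := measurable_ones s.
  by transitivity (mass P (ones s))%:E; [exact: massE|rewrite PQ -massE].
- by move=> _; apply: (@le_lt_trans _ _ 1%E); [exact: probability_le1|exact: ltry].
Qed.

(** Interleaving their digits identifies a pair of codes with a single code. *)
Definition even_code (c : codes) : codes := fun k => c k.*2.
Definition odd_code (c : codes) : codes := fun k => c k.*2.+1.

Definition merge_codes (a b : codes) : codes :=
  fun k => if odd k then b k./2 else a k./2.

Lemma even_merge a b : even_code (merge_codes a b) = a.
Proof.
by apply/funext => k; rewrite /even_code /merge_codes odd_double doubleK.
Qed.

Lemma odd_merge a b : odd_code (merge_codes a b) = b.
Proof.
by apply/funext => k; rewrite /odd_code /merge_codes /= odd_double/= uphalf_double.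
Qed.

Lemma measurable_even_code : measurable_fun setT even_code.
Proof. by apply: measurable_to_code => k; exact: measurable_digit. Qed.

Lemma measurable_odd_code : measurable_fun setT odd_code.
Proof. by apply: measurable_to_code => k; exact: measurable_digit. Qed.

Lemma even_odd_ones s t : even_code @^-1` ones s `&` odd_code @^-1` ones t =
  ones ([seq k.*2 | k <- s] ++ [seq k.*2.+1 | k <- t]).
Proof.
rewrite -onesI; apply/seteqP; split => c; rewrite /ones/= !all_map;
  by move=> [cs ct]; split.
Qed.

Section coupling_compact.
Context (R : realType) (I : Type) (F : set_system I) (UF : UltraFilter F).
Context d1 d2 (S : measurableType d1) (T : measurableType d2).
Context (mu : probability S R) (nu : probability T R).
Context (cS : S -> codes) (rS : codes -> S) (cT : T -> codes) (rT : codes -> T).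
Hypotheses (mcS : measurable_fun setT cS) (mrS : measurable_fun setT rS).
Hypotheses (mcT : measurable_fun setT cT) (mrT : measurable_fun setT rT).
Hypotheses (rSK : cancel cS rS) (rTK : cancel cT rT).
Context (pi_ : I -> probability (S * T)%type R).
Hypothesis pi_fst : forall i A, measurable A -> pi_ i (fst @^-1` A) = mu A.
Hypothesis pi_snd : forall i B, measurable B -> pi_ i (snd @^-1` B) = nu B.

(** Encode the couplings as probabilities on codes, take a limit there and push it
    back along the retraction. The push-forward retains all the mass: the
    marginals of the limit on codes are those of the encoded couplings, which are
    the laws of encoded points, and on such codes the retractions invert the
    encodings. *)
Lemma coupling_compact : exists pi : probability (S * T)%type R,
  [/\ forall A, measurable A -> pi (fst @^-1` A) = mu A,
      forall B, measurable B -> pi (snd @^-1` B) = nu B &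
      forall A B, measurable A -> measurable B ->
        mass (pi_ i) (A `*` B) @[i --> F] --> mass pi (A `*` B)].
Proof.
pose c (z : S * T) : codes := merge_codes (cS z.1) (cT z.2).
have mc : measurable_fun setT c.
  apply: measurable_to_code => k; rewrite /c /merge_codes.
  have mdigit d (V : measurableType d) (h : V -> codes) : measurable_fun setT h ->
      measurable [set z | h z k./2].
    move=> mh; rewrite -[X in measurable X]setTI.
    exact: mh measurableT _ (measurable_digit _).
  case: (odd k); [apply: (mdigit _ _ (cT \o snd))|apply: (mdigit _ _ (cS \o fst))].
    exact: measurableT_comp mcT measurable_snd.
  exact: measurableT_comp mcS measurable_fst.
have /choice[P_ P_E] i := probability_push (pi_ i) mc.
have [P cP] := codes_compact P_ UF.
have [Pe PeE] := probability_push P measurable_even_code.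
have [Po PoE] := probability_push P measurable_odd_code.
have [muc mucE] := probability_push mu mcS.
have [nuc nucE] := probability_push nu mcT.
have P_even i A : measurable A -> P_ i (even_code @^-1` A) = muc A.
  move=> mA; rewrite P_E mucE -(pi_fst i); last first.
    by rewrite -[X in measurable X]setTI; exact: mcS.
  by congr (pi_ i _); apply/seteqP; split => z; rewrite /= /c even_merge.
have P_odd i B : measurable B -> P_ i (odd_code @^-1` B) = nuc B.
  move=> mB; rewrite P_E nucE -(pi_snd i); last first.
    by rewrite -[X in measurable X]setTI; exact: mcT.
  by congr (pi_ i _); apply/seteqP; split => z; rewrite /= /c odd_merge.
have cP2 s t : mass (P_ i) (even_code @^-1` ones s `&` odd_code @^-1` ones t)
    @[i --> F] --> mass P (even_code @^-1` ones s `&` odd_code @^-1` ones t).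
  by rewrite even_odd_ones; exact: cP.
(* The first marginals of the [P_ i] agree with one another on the sets [ones s],
   so the limit agrees with them there, hence everywhere. *)
have P_even' A : measurable A -> P (even_code @^-1` A) = muc A.
  move=> mA; rewrite -PeE; apply: probability_codes_unique => // s.
  have := cP2 s [::]; rewrite ones_nil preimage_setT setIT => h.
  rewrite {1}/mass PeE -/(mass _ _); apply: (cvg_unique _ h) => //=.
  rewrite (_ : (fun i => _) = cst (mass muc (ones s))); first exact: cvg_cst.
  by apply/funext => i; rewrite /mass P_even//; exact: measurable_ones.
have P_odd' B : measurable B -> P (odd_code @^-1` B) = nuc B.
  move=> mB; rewrite -PoE; apply: probability_codes_unique => // t.
  have := cP2 [::] t; rewrite ones_nil preimage_setT setTI => h.
  rewrite {1}/mass PoE -/(mass _ _); apply: (cvg_unique _ h) => //=.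
  rewrite (_ : (fun i => _) = cst (mass nuc (ones t))); first exact: cvg_cst.
  by apply/funext => i; rewrite /mass P_odd//; exact: measurable_ones.
pose r (a : codes) : S * T := (rS (even_code a), rT (odd_code a)).
have mr : measurable_fun setT r.
  apply: measurable_fun_pair.
    exact: measurableT_comp mrS measurable_even_code.
  exact: measurableT_comp mrT measurable_odd_code.
have [pi piE] := probability_push P mr.
have mrS' A : measurable A -> measurable (rS @^-1` A).
  by move=> mA; rewrite -[X in measurable X]setTI; exact: mrS.
have mrT' B : measurable B -> measurable (rT @^-1` B).
  by move=> mB; rewrite -[X in measurable X]setTI; exact: mrT.
exists pi; split.
- move=> A mA; rewrite piE -[LHS]/(P (even_code @^-1` (rS @^-1` A))).
  rewrite P_even'; last exact: mrS'.
  by rewrite mucE; congr (mu _); apply/seteqP; split => x; rewrite /= rSK.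
- move=> B mB; rewrite piE -[LHS]/(P (odd_code @^-1` (rT @^-1` B))).
  rewrite P_odd'; last exact: mrT'.
  by rewrite nucE; congr (nu _); apply/seteqP; split => x; rewrite /= rTK.
move=> A B mA mB.
have -> : mass pi (A `*` B) =
    mass P (even_code @^-1` (rS @^-1` A) `&` odd_code @^-1` (rT @^-1` B)).
  by rewrite /mass piE.
have -> : (fun i => mass (pi_ i) (A `*` B)) = (fun i =>
    mass (P_ i) (even_code @^-1` (rS @^-1` A) `&` odd_code @^-1` (rT @^-1` B))).
  apply/funext => i; rewrite /mass P_E; congr (fine (pi_ i _)).
  by apply/seteqP; split => -[x y]; rewrite /= /c even_merge odd_merge rSK rTK.
have Tones : range ones setT by exists [::] => //; rewrite ones_nil.
apply: (@cvg_mass_rectangle _ _ F _ _ codes P_ P _ _ codes codes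
  even_code odd_code (range ones) (range ones)) => //.
- exact: measurable_even_code.
- exact: measurable_odd_code.
- by move=> i C mC; rewrite /mass P_even// P_even'.
- by move=> i C mC; rewrite /mass P_odd// P_odd'.
- exact: setI_closed_ones.
- exact: setI_closed_ones.
- by move=> _ _ [s _ <-] [t _ <-]; exact: cP2.
- exact: mrS'.
- exact: mrT'.
Qed.

End coupling_compact.

(** * Lower semicontinuity of masses *)

(** The bound [l <= liminf u], without reference to a lower limit: this form makes
    sense along any filter. *)
Definition lsc_along (R : realType) (I : Type) (F : set_system I)
    (u : I -> R) (l : R) := forall a, a < l -> \forall i \near F, a < u i.

Section lsc_along.
Context (R : realType) (I : Type) (F : set_system I) {FF : ProperFilter F}.
Implicit Types u v : I -> R.

Lemma cvg_lsc u l : u i @[i --> F] --> l -> lsc_along F u l.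
Proof. by move=> ul a al; exact: cvgr_gt ul _ al. Qed.

Lemma lscD u v l m : lsc_along F u l -> lsc_along F v m ->
  lsc_along F (fun i => u i + v i) (l + m).
Proof.
move=> ul vm a alm; pose e := (l + m - a) / 2.
have := ul (l - e); have := vm (m - e).
have e0 : 0 < e by rewrite /e; lra.
rewrite !ltrBlDr !ltrDl => /(_ e0) v1 /(_ e0) u1.
apply: filterS2 u1 v1 => i ui vi.
by rewrite /e in ui vi; lra.
Qed.

Lemma lscM u l c : 0 < c -> lsc_along F u l ->
  lsc_along F (fun i => c * u i) (c * l).
Proof.
move=> c0 ul a; rewrite -ltr_pdivrMl// => /ul; apply: filterS => i.
by rewrite ltr_pdivrMl.
Qed.

Lemma lsc_sum n (u_ : nat -> I -> R) (l_ : nat -> R) :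
  (forall k, lsc_along F (u_ k) (l_ k)) ->
  lsc_along F (fun i => \sum_(k < n) u_ k i) (\sum_(k < n) l_ k).
Proof.
move=> ul; elim: n => [|n IHn] a.
  by rewrite big_ord0 => a0; apply: nearW => i; rewrite big_ord0.
rewrite big_ord_recr/= => /(lscD IHn (ul n)).
by apply: filterS => i; rewrite big_ord_recr.
Qed.

End lsc_along.

Section open_sets.
Context (R : realType) (I : Type) (F : set_system I) {FF : ProperFilter F}.
Context d (O : measurableType d) (P_ : I -> probability O R).
Context (P : probability O R).
Context (K : set (set O)).
Hypothesis mK : forall A, K A -> measurable A.
Hypothesis KI : setI_closed K.
Hypothesis cK : forall A, K A -> mass (P_ i) A @[i --> F] --> mass P A.

(** Inclusion-exclusion on the last set: intersecting it with the others gives a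
    union of fewer members of the pi-system [K]. *)
Lemma cvg_mass_bigsetU n (E : (set O)^nat) : (forall k, K (E k)) ->
  mass (P_ i) (\big[setU/set0]_(k < n) E k) @[i --> F] -->
  mass P (\big[setU/set0]_(k < n) E k).
Proof.
elim: n E => [|n IHn] E KE.
  by rewrite big_ord0 mass0; under eq_fun do rewrite mass0; exact: cvg_cst.
have massS (Q : probability O R) : mass Q (\big[setU/set0]_(k < n.+1) E k) =
    mass Q (\big[setU/set0]_(k < n) E k) + mass Q (E n) -
    mass Q (\big[setU/set0]_(k < n) (E k `&` E n)).
  rewrite big_ord_recr/= massUI ?big_distrl//; last exact: mK.
  by apply: bigsetU_measurable => k _; exact: mK.
rewrite massS; under eq_fun do rewrite massS.
apply: cvgB; first by apply: cvgD; [exact: IHn|exact: cK].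
by apply: (IHn (fun k => E k `&` E n)) => k; exact: KI.
Qed.

(** A finite subunion already has almost all of the limit mass. *)
Lemma lsc_mass_bigcup (E : (set O)^nat) : (forall k, K (E k)) ->
  lsc_along F (fun i => mass (P_ i) (\bigcup_k E k)) (mass P (\bigcup_k E k)).
Proof.
move=> KE a aP.
have mE k : measurable (E k) by exact: mK.
have [n an] : exists n, a < mass P (\big[setU/set0]_(k < n) E k).
  exact: filter_ex (cvg_lsc (cvg_mass_bigcup mE) aP).
have cU := @cvg_mass_bigsetU n E KE.
have := cvg_lsc (FF := FF) cU an.
apply: filterS => i ai; apply: (lt_le_trans ai); apply: le_mass.
- exact: bigsetU_measurable.
- exact: bigcupT_measurable.
- exact: bigsetU_bigcup.
Qed.

End open_sets.

(** * Lower semicontinuity of Lp norms *)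

Section layers.
Context (R : realType).
Implicit Types y e : R.

(** For positive [e] and [y], the sum over [k] of [layer e y k] is the largest
    multiple of [e] strictly below [y]. *)
Definition layer e y k : R := e * (k.+1%:R * e < y)%R%:R.

Lemma layer_ge0 e y k : 0 < e -> 0 <= layer e y k.
Proof. by move=> e0; rewrite mulr_ge0// ltW. Qed.

Lemma sum_layer_le e y n : 0 < e -> 0 <= y -> \sum_(k < n) layer e y k <= y.
Proof.
move=> e0 y0; have crude m : \sum_(k < m) layer e y k <= m%:R * e.
  elim: m => [|m IHm]; first by rewrite big_ord0 mul0r.
  rewrite big_ord_recr/= -natr1 mulrDl mul1r.
  by rewrite lerD// ler_piMr ?(ltW e0)// lern1 leq_b1.
elim: n => [|n IHn]; first by rewrite big_ord0.
have [ny|ny] := boolP (n.+1%:R * e < y)%R.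
  by rewrite (le_trans (crude _))// ltW.
by rewrite big_ord_recr/= {2}/layer (negbTE ny) mulr0 addr0.
Qed.

Lemma le_sum_layer e y n : 0 < e -> y <= n.+1%:R * e ->
  y <= e + \sum_(k < n) layer e y k.
Proof.
move=> e0 yn.
(* Truncating [y] at the highest level reached makes the bound inductive. *)
suff : Num.min y (n.+1%:R * e) <= e + \sum_(k < n) layer e y k by rewrite min_l.
elim: n {yn} => [|n IHn].
  by rewrite big_ord0 mul1r addr0 ge_min lexx orbT.
rewrite big_ord_recr/= {2}/layer.
have [ny|ny] := boolP (n.+1%:R * e < y)%R.
  rewrite min_r ?(ltW ny)// in IHn.
  by rewrite mulr1 addrA -[n.+2%:R]natr1 mulrDl mul1r ge_min lerD2r IHn orbT.
rewrite -leNgt in ny; rewrite min_l// in IHn.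
by rewrite mulr0 addr0 ge_min IHn.
Qed.

End layers.

Section lsc_integral.
Context (R : realType) (I : Type) (F : set_system I) {FF : ProperFilter F}.
Context d (O : measurableType d) (P_ : I -> probability O R).
Context (P : probability O R).

Lemma measurable_superlevel (g : O -> R) (t : R) : measurable_fun setT g ->
  measurable [set q | t < g q].
Proof.
move=> mg; rewrite -[X in measurable X]setTI.
rewrite (_ : [set q | t < g q] = g @^-1` `]t, +oo[); first exact: mg.
by apply/seteqP; split => q /=; rewrite in_itv/= andbT.
Qed.

Lemma layer_indic (g : O -> R) e k : (fun q => layer e (g q) k) =
  (fun q => e * \1_[set q | k.+1%:R * e < g q] q).
Proof.
apply/funext => q; rewrite /layer indicE; congr (_ * (nat_of_bool _)%:R).
by apply/idP/idP => [?|/set_mem//]; exact: mem_set.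
Qed.

Lemma measurable_layer (g : O -> R) e k : measurable_fun setT g ->
  measurable_fun setT (fun q => layer e (g q) k).
Proof.
move=> mg; rewrite layer_indic; apply: measurable_funM => //.
by apply: measurable_indic; exact: measurable_superlevel.
Qed.

Lemma integral_layer (Q : probability O R) (g : O -> R) e k :
  measurable_fun setT g -> 0 < e ->
  (\int[Q]_q (layer e (g q) k)%:E)%E =
  (e * mass Q [set q | (k.+1%:R * e < g q)%R])%:E.
Proof.
move=> mg e0; have mU := measurable_superlevel (k.+1%:R * e) mg.
under eq_integral do rewrite (congr1 (@^~ _) (layer_indic g e k)) EFinM.
rewrite ge0_integralZl_EFin//; last 2 first.
  exact/measurable_EFinP/measurable_indic.
  exact: ltW.
by rewrite integral_indic// setIT EFinM; congr (_ * _)%E; exact: massE.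
Qed.

(** The partial sums of [e * P {g > k e}] are lower semicontinuous and bounded by
    the integral of [g], hence bounded by [b] in the limit; and their limit is,
    up to [e], an upper bound of the integral of [g] under [P]. *)
Lemma lsc_integral (g : O -> R) (b : R) : measurable_fun setT g ->
  (forall q, 0 <= g q) ->
  (forall t, 0 <= t -> lsc_along F (fun i => mass (P_ i) [set q | t < g q])
     (mass P [set q | t < g q])) ->
  (\forall i \near F, (\int[P_ i]_q (g q)%:E <= b%:E)%E) ->
  (\int[P]_q (g q)%:E <= b%:E)%E.
Proof.
move=> mg g0 lscg intb; have ml e k := measurable_layer e k mg.
have layers_le e n : 0 < e ->
    \sum_(k < n) e * mass P [set q | k.+1%:R * e < g q] <= b.
  move=> e0; rewrite leNgt; apply/negP => blt.
  have lsck k : lsc_along F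
      (fun i => e * mass (P_ i) [set q | k.+1%:R * e < g q])
      (e * mass P [set q | k.+1%:R * e < g q]).
    by apply: lscM => //; apply: lscg; rewrite mulr_ge0// ltW.
  have nearb := lsc_sum (FF := FF) lsck blt.
  have [i [ib1 ib2]] := filter_ex (filterI nearb intb).
  move: ib1; rewrite ltNge => /negP; apply; rewrite -lee_fin.
  apply: le_trans ib2; rewrite -sumEFin.
  under eq_bigr do rewrite -integral_layer//.
  rewrite -ge0_integral_sum//; last 2 first.
    by move=> k; exact/measurable_EFinP.
    by move=> k q _; rewrite lee_fin layer_ge0.
  apply: ge0_le_integral => //.
  - by move=> q _; rewrite sume_ge0// => k _; rewrite lee_fin layer_ge0.
  - by apply: emeasurable_sum => k; exact/measurable_EFinP.
  - exact/measurable_EFinP.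
  - by move=> q _; rewrite sumEFin lee_fin sum_layer_le.
apply/lee_addgt0Pr => e e0.
pose h q := (\sum_(0 <= k <oo) (layer e (g q) k)%:E)%E.
have l0 q k : (0 <= (layer e (g q) k)%:E)%E by rewrite lee_fin layer_ge0.
have mh : measurable_fun setT h.
  by apply: ge0_emeasurable_sum => // k _; exact/measurable_EFinP.
have h0 q : (0 <= h q)%E by exact: nneseries_ge0.
apply: (@le_trans _ _ (\int[P]_q (e%:E + h q))%E).
  apply: ge0_le_integral => //.
  - by move=> q _; rewrite lee_fin.
  - exact/measurable_EFinP.
  - exact: emeasurable_funD.
  - move=> q _; have [n gn] : exists n, g q <= n.+1%:R * e.
      exists (Num.truncn (g q / e)); rewrite -ler_pdivrMr//.
      exact/ltW/truncnS_gt.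
    apply: (@le_trans _ _ (e%:E + (\sum_(k < n) layer e (g q) k)%:E)%E).
      by rewrite -EFinD lee_fin le_sum_layer.
    rewrite leeD2l//; apply: le_trans (nneseries_lim_ge n _) => //.
    by rewrite -sumEFin big_mkord.
rewrite ge0_integralD//; last by move=> q _; rewrite lee_fin ltW.
rewrite integral_cst// [X in (_ * X)%E]probability_setT mule1 addeC leeD2r//.
rewrite integral_nneseries//; last by move=> k; exact/measurable_EFinP.
apply: lime_le.
  by apply: is_cvg_nneseries => k _ _; exact: integral_ge0.
apply: nearW => n; rewrite big_mkord.
under eq_bigr do rewrite integral_layer//.
by rewrite sumEFin lee_fin layers_le.
Qed.

(** For finite [p] the [p]-th power of the norm is an integral whose superlevel
    sets are those of [f]. For [p = +oo] the norm is at most [b] exactly when the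
    set where [f > b] is null. *)
Lemma lsc_Lnorm (p : \bar R) (f : O -> R) (b : \bar R) : (1 <= p)%E ->
  measurable_fun setT f -> (forall q, 0 <= f q) ->
  (forall t, 0 <= t -> lsc_along F (fun i => mass (P_ i) [set q | t < f q])
     (mass P [set q | t < f q])) ->
  (\forall i \near F, (Lnorm (P_ i) p (EFin \o f) <= b)%E) ->
  (Lnorm P p (EFin \o f) <= b)%E.
Proof.
move=> p1 mf f0 lscf Lb.
have b0 : (0 <= b)%E.
  by have [i ib] := filter_ex Lb; apply: le_trans ib; exact: Lnorm_ge0.
case: b b0 Lb => [b| |//]; last by move=> *; rewrite leey.
rewrite lee_fin => b0 Lb.
case: p p1 Lb => [r| |//]; last first.
  move=> _ Lb.
  have LE (Q : probability O R) : Lnorm Q +oo%E (EFin \o f) =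
      ess_sup Q (abse \o (EFin \o f)).
    by rewrite unlock [X in (_ < X)%E]probability_setT lte01.
  have ae0 (Q : probability O R) : mass Q [set q | b < f q] = 0 <->
      (ess_sup Q (abse \o (EFin \o f)) <= b%:E)%E.
    have mU := measurable_superlevel b mf.
    have UE : ~` [set q | (abse \o (EFin \o f)) q <= b%:E]%E = [set q | b < f q].
      apply/seteqP; split => q /=; rewrite lee_fin ger0_norm//.
        by move/negP; rewrite -ltNge.
      by rewrite ltNge => /negP.
    split => [Q0|/ess_supP Qae].
      apply/ess_supP.
      suff : Q.-negligible [set q | b < f q] by rewrite -UE.
      by apply/negligibleP => //; rewrite [LHS](massE Q mU) Q0.
    have : Q.-negligible [set q | b < f q] by rewrite -UE.
    by move=> /negligibleP Q0; rewrite /mass [X in fine X]Q0.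
  rewrite LE; apply/ae0/eqP; rewrite eq_le mass_ge0 andbT leNgt; apply/negP => Pb.
  have [i [ib1 ib2]] := filter_ex (filterI (lscf b b0 0 Pb) Lb).
  move: ib2; rewrite LE => /ae0 ib2.
  by rewrite ib2 ltxx in ib1.
rewrite lee_fin => r1 Lb; have r0 : 0 < r by exact: lt_le_trans r1.
have rn0 : r != 0 by rewrite gt_eqF.
have powE q : (`|(EFin \o f) q| `^ r)%E = (f q `^ r)%:E.
  by rewrite /= ger0_norm.
have Lpow (Q : probability O R) : (Lnorm Q r%:E (EFin \o f) <= b%:E)%E =
    (\int[Q]_q (f q `^ r)%:E <= (b `^ r)%:E)%E.
  under eq_integral do rewrite -powE.
  rewrite -poweR_Lnorm// -poweR_EFin.
  have inv_pow x : (0 <= x)%E -> ((x `^ r) `^ r^-1)%E = x.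
    by move=> x0; rewrite -poweRrM mulfV// poweRe1.
  have L0 := Lnorm_ge0 Q r%:E (EFin \o f).
  apply/idP/idP => Lle.
    by apply: gt0_ler_poweR; rewrite ?in_itv/= ?leey ?andbT ?(ltW r0)// lee_fin.
  rewrite -(inv_pow _ L0) -(inv_pow b%:E); last by rewrite lee_fin.
  by apply: gt0_ler_poweR; rewrite ?in_itv/= ?leey ?andbT ?invr_ge0 ?(ltW r0)//
    ?poweR_ge0 ?lee_fin ?powR_ge0.
rewrite Lpow; apply: lsc_integral.
- exact: measurableT_comp (measurable_powR r) mf.
- by move=> q; exact: powR_ge0.
- move=> t t0.
  have -> : [set q | t < f q `^ r] = [set q | t `^ r^-1 < f q].
    have inv_pow (x s : R) : 0 <= x -> s != 0 -> (x `^ s) `^ s^-1 = x.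
      by move=> x0 s0; rewrite -powRrM mulfV// powRr1.
    apply/seteqP; split => q /= tq.
      rewrite -(inv_pow (f q) r)//; apply: gt0_ltr_powR => //.
      - by rewrite invr_gt0.
      - by rewrite nnegrE powR_ge0.
    rewrite -(inv_pow t r^-1)// ?invr_neq0// invrK; apply: gt0_ltr_powR => //;
      by rewrite nnegrE ?powR_ge0.
  exact: (lscf (t `^ r^-1) (powR_ge0 _ _)).
- by move: Lb; apply: filterS => i; rewrite Lpow.
Qed.

End lsc_integral.

(** * The distortion of a coupling *)

(** If [d(u, v) > a], then [u] and [v] can be replaced by points of a dense
    sequence so close to them that the distance of these two points certifies
    the inequality for all pairs of points of the two small balls. *)
Lemma mdist_gt_rectangles (R : realType) (Z : completeMetricType R) (a : R) :
  separable Z -> exists V W : nat -> set Z,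
  [/\ forall n, open (V n), forall n, open (W n) &
      forall u v, a < mdist u v <-> exists2 n, V n u & W n v].
Proof.
move=> /dense_sequence[d dd].
have d_dense (x : Z) k : exists j, mdist x (d j) < recip k.
  have [||j dj] := dd [set y | mdist y x < recip k].
  - exact: open_mdist_ball.
  - by exists x; rewrite /= mdistxx recip_gt0.
  - by exists j; rewrite metric_sym.
(* [n] codes two indices into the dense sequence and one of a radius; pairs of
   balls whose centers are too near to each other are replaced by empty sets. *)
pose idx n : nat * nat * nat := odflt (0, 0, 0)%N (unpickle n).
pose far n := a + recip (idx n).2 *+ 2 <
  mdist (d (idx n).1.1) (d (idx n).1.2).
pose B j n := if far n then [set y | mdist y (d j) < recip (idx n).2] else set0.
have oB j n : open (B j n).
  by rewrite /B; case: ifP => _; [exact: open_mdist_ball|exact: open0].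
exists (fun n => B (idx n).1.1 n), (fun n => B (idx n).1.2 n); split => // u v.
split => [auv|[n]]; last first.
  rewrite /B /far; case: ifP => //= farn un vn.
  have := metric_triangle (d (idx n).1.1) u (d (idx n).1.2).
  have := metric_triangle u v (d (idx n).1.2).
  by rewrite (metric_sym (d (idx n).1.1) u); move: farn un vn; rewrite mulr2n; lra.
have [k ka] : exists k, recip k < (mdist u v - a) / 4%:R.
  by apply: recip_lt_ex; rewrite divr_gt0// subr_gt0.
have [i ui] := d_dense u k.
have [j vj] := d_dense v k.
have idxE : idx (pickle (i, j, k)) = (i, j, k) by rewrite /idx pickleK.
have farn : far (pickle (i, j, k)).
  rewrite /far idxE /= mulr2n.
  have := metric_triangle u (d i) v; have := metric_triangle (d i) (d j) v.
  by rewrite (metric_sym (d j) v); move: ka ui vj; lra.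
by exists (pickle (i, j, k)); rewrite /B farn idxE.
Qed.

Section couplings.
Context (R : realType) (Z : completeMetricType R) (p : \bar R).
Context (X Y : network Z p).

Lemma product_coupling : exists pi : probability (borel X * borel Y)%type R,
  coupling pi.
Proof.
exists (prob X \x prob Y)%E; split => A mA; rewrite /pushforward.
  rewrite (_ : fst @^-1` A = A `*` setT); last by rewrite setXT.
  by rewrite /= product_measure1E// [X in (_ * X)%E]probability_setT mule1.
rewrite (_ : snd @^-1` A = setT `*` A); last by rewrite setTX.
by rewrite /= product_measure1E// [X in (X * _)%E]probability_setT mul1e.
Qed.

Let O := ((borel X * borel Y) * (borel X * borel Y))%type.
Let xx (q : O) : borel X * borel X := (q.1.1, q.2.1).
Let yy (q : O) : borel Y * borel Y := (q.1.2, q.2.2).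

Definition distortion (q : O) : R := mdist (omega (xx q)) (omega (yy q)).

Let mxx : measurable_fun setT xx.
Proof.
apply: measurable_fun_pair.
  exact: measurableT_comp measurable_fst measurable_fst.
exact: measurableT_comp measurable_fst measurable_snd.
Qed.

Let myy : measurable_fun setT yy.
Proof.
apply: measurable_fun_pair.
  exact: measurableT_comp measurable_snd measurable_fst.
exact: measurableT_comp measurable_snd measurable_snd.
Qed.

(** The square of a coupling, regrouped as a probability on X^2 x Y^2, is a
    coupling of the squares of the marginals. This is what makes the pi-lambda
    argument applicable to squares. *)
Lemma coupling_square_fst (pi : probability (borel X * borel Y)%type R) A :
  coupling pi -> measurable A -> (pi \x pi)%E (xx @^-1` A) = (prob X \x prob X)%E A.
Proof.
move=> [piX _] mA; have [Q QE] := probability_push (pi \x pi)%E mxx.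
rewrite -QE; apply/esym; apply: product_measure_unique => // B C mB mC.
rewrite [LHS]QE (_ : xx @^-1` (B `*` C) = (fst @^-1` B) `*` (fst @^-1` C)); last first.
  by apply/seteqP; split => -[[x y] [x' y']].
rewrite [LHS]product_measure1E; first by congr (_ * _)%E; exact: piX.
  by rewrite -[X in measurable X]setTI; exact: measurable_fst.
by rewrite -[X in measurable X]setTI; exact: measurable_fst.
Qed.

Lemma coupling_square_snd (pi : probability (borel X * borel Y)%type R) A :
  coupling pi -> measurable A -> (pi \x pi)%E (yy @^-1` A) = (prob Y \x prob Y)%E A.
Proof.
move=> [_ piY] mA; have [Q QE] := probability_push (pi \x pi)%E myy.
rewrite -QE; apply/esym; apply: product_measure_unique => // B C mB mC.
rewrite [LHS]QE (_ : yy @^-1` (B `*` C) = (snd @^-1` B) `*` (snd @^-1` C)); last first.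
  by apply/seteqP; split => -[[x y] [x' y']].
rewrite [LHS]product_measure1E; first by congr (_ * _)%E; exact: piY.
  by rewrite -[X in measurable X]setTI; exact: measurable_snd.
by rewrite -[X in measurable X]setTI; exact: measurable_snd.
Qed.

Section limit.
Context (I : Type) (F : set_system I) {FF : ProperFilter F}.
Context (pi_ : I -> probability (borel X * borel Y)%type R).
Context (pi : probability (borel X * borel Y)%type R).
Hypothesis coupling_pi_ : forall i, coupling (pi_ i).
Hypothesis coupling_pi : coupling pi.
Hypothesis cvg_pi : forall A B, measurable A -> measurable B ->
  mass (pi_ i) (A `*` B) @[i --> F] --> mass pi (A `*` B).

(** On the boxes that generate the two product sigma-algebras, the mass under the
    square of a coupling is a product of two masses of rectangles. *)
Lemma cvg_mass_square_rectangle C D : measurable C -> measurable D ->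
  mass (pi_ i \x pi_ i)%E (xx @^-1` C `&` yy @^-1` D) @[i --> F] -->
  mass (pi \x pi)%E (xx @^-1` C `&` yy @^-1` D).
Proof.
move=> mC mD.
have boxI d (T : measurableType d) :
    setI_closed [set A `*` B | A in @measurable _ T & B in @measurable _ T].
  move=> _ _ [A mA [B mB <-]] [A' mA' [B' mB' <-]]; rewrite -setXI.
  by exists (A `&` A'); [exact: measurableI|exists (B `&` B') => //; exact: measurableI].
have boxT d (T : measurableType d) :
    [set A `*` B | A in @measurable _ T & B in @measurable _ T] setT.
  by exists setT => //; exists setT => //; rewrite setXTT.
apply: (@cvg_mass_rectangle _ _ F _ _ O (fun i => (pi_ i \x pi_ i)%E) (pi \x pi)%E
  _ _ _ _ xx yy _ _ mxx myy _ _ _ (boxI _ _) (boxT _ _) _ (boxI _ _) (boxT _ _)) => //.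
- move=> i A mA; congr fine.
  transitivity ((prob X \x prob X)%E A); first exact: coupling_square_fst.
  exact/esym/coupling_square_fst.
- move=> i A mA; congr fine.
  transitivity ((prob Y \x prob Y)%E A); first exact: coupling_square_snd.
  exact/esym/coupling_square_snd.
- exact: measurable_prod_measurableType.
- exact: measurable_prod_measurableType.
move=> _ _ [A mA [A' mA' <-]] [B mB [B' mB' <-]].
have massX (Q : probability (borel X * borel Y)%type R) :
    mass (Q \x Q)%E (xx @^-1` (A `*` A') `&` yy @^-1` (B `*` B')) =
    mass Q (A `*` B) * mass Q (A' `*` B').
  rewrite /mass (_ : _ `&` _ = (A `*` B) `*` (A' `*` B')); last first.
    by apply/seteqP; split => -[[x y] [x' y']] /=; tauto.
  have mAB : measurable (A `*` B) by exact: measurableX.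
  have mAB' : measurable (A' `*` B') by exact: measurableX.
  by rewrite [X in fine X]product_measure1E// fineM// fin_num_measure.
rewrite massX; under eq_fun do rewrite massX.
by apply: cvgM; exact: cvg_pi.
Qed.

Lemma superlevel_rectangles (a : R) : separable Z ->
  exists (C : nat -> set (borel X * borel X)) (D : nat -> set (borel Y * borel Y)),
  [/\ forall n, measurable (C n), forall n, measurable (D n) &
      [set q | a < distortion q] = \bigcup_n (xx @^-1` C n `&` yy @^-1` D n)].
Proof.
move=> /(mdist_gt_rectangles a)[V [W [oV oW VW]]].
exists (fun n => @omega R Z p X @^-1` V n), (fun n => @omega R Z p Y @^-1` W n); split.
- move=> n; rewrite -[X in measurable X]setTI.
  by apply: (@omega_measurable R Z p X) => //; exact: sub_sigma_algebra.
- move=> n; rewrite -[X in measurable X]setTI.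
  by apply: (@omega_measurable R Z p Y) => //; exact: sub_sigma_algebra.
- apply/seteqP; split => q /=; first by move=> /VW[n Vn Wn]; exists n.
  by move=> [n _ [Vn Wn]]; apply/VW; exists n.
Qed.

Lemma measurable_distortion : separable Z -> measurable_fun setT distortion.
Proof.
move=> sepZ; apply: (measurability _ (RGenOInfty.measurableE R)) => //.
move=> _ [_ [a ->] <-]; rewrite setTI.
have [C [D [mC mD CD]]] := superlevel_rectangles a sepZ.
rewrite (_ : _ @^-1` _ = [set q | a < distortion q]); last first.
  by apply/seteqP; split => q /=; rewrite in_itv/= andbT.
rewrite CD; apply: bigcupT_measurable => n; apply: measurableI.
  by rewrite -[X in measurable X]setTI; exact: mxx.
by rewrite -[X in measurable X]setTI; exact: myy.
Qed.

(** The superlevel sets of the distortion are countable unions of sets on which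
    the squares of the couplings converge. *)
Lemma lsc_dis (b : \bar R) : separable Z -> (1 <= p)%E ->
  (\forall i \near F, (dis (pi_ i) <= b)%E) -> (dis pi <= b)%E.
Proof.
move=> sepZ p1.
apply: (@lsc_Lnorm R I F FF _ O (fun i => (pi_ i \x pi_ i)%E) (pi \x pi)%E
  p distortion b p1 (measurable_distortion sepZ)).
  by move=> q; exact: mdist_ge0.
move=> t _; have [C [D [mC mD ->]]] := superlevel_rectangles t sepZ.
apply: (@lsc_mass_bigcup R I F FF _ O (fun i => (pi_ i \x pi_ i)%E) (pi \x pi)%E
  [set xx @^-1` A `&` yy @^-1` B | A in measurable & B in measurable]).
- move=> _ [A mA [B mB <-]]; apply: measurableI.
    by rewrite -[X in measurable X]setTI; exact: mxx.
  by rewrite -[X in measurable X]setTI; exact: myy.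
- move=> _ _ [A mA [B mB <-]] [A' mA' [B' mB' <-]].
  exists (A `&` A'); first exact: measurableI.
  exists (B `&` B'); first exact: measurableI.
  by apply/seteqP; split => q [[? ?] [? ?]]; split; split.
- by move=> _ [A mA [B mB <-]]; exact: cvg_mass_square_rectangle.
- by move=> n; exists (C n) => //; exists (D n).
Qed.

End limit.

End couplings.

(** * Existence of an optimal coupling *)

Theorem theorem26 (R : realType) (Z : completeMetricType R) (p : \bar R)
    (sepZ : separable Z) (p1 : (1 <= p)%E) (X Y : network Z p) :
  exists pi : probability (borel X * borel Y)%type R,
    coupling pi /\ GW X Y = ((2^-1)%R%:E * dis pi)%E.
Proof.
pose S := [set dis pi | pi in [set pi | @coupling R Z p X Y pi]].
suff [pi [cpi pi_le]] : exists pi, @coupling R Z p X Y pi /\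
    (dis pi <= ereal_inf S)%E.
  exists pi; split => //; congr (_ * _)%E; apply/eqP; rewrite eq_le pi_le andbT.
  by apply: ereal_inf_lbound; exists pi.
(* If every coupling has infinite distortion, any coupling is optimal. *)
have [Sy|Sy] := eqVneq (ereal_inf S) +oo%E.
  by have [pi cpi] := product_coupling X Y; exists pi; rewrite Sy leey.
have Sfin : ereal_inf S \is a fin_num.
  rewrite ge0_fin_numE ?ltey//; apply: le_ereal_inf_tmp => _ [pi _ <-].
  exact: Lnorm_ge0.
have /choice[pi_ piP] n : exists pi, @coupling R Z p X Y pi /\
    (dis pi < ereal_inf S + (recip n)%:E)%E.
  have [_ [pi cpi <-] pi_lt] := lb_ereal_inf_adherent (recip_gt0 R n) Sfin.
  by exists pi.
(* Finer than [\oo], so that the eventual bounds on the distortions hold along [F]. *)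
have [F [UF ooF]] := ultraFilterLemma eventually_filter.
have [cX [rX [mcX mrX rXK]]] := polish_code_retract (space_polish X).
have [cY [rY [mcY mrY rYK]]] := polish_code_retract (space_polish Y).
have [pi [piX piY cvg_pi]] := coupling_compact UF mcX mrX mcY mrY rXK rYK
  (fun i => (piP i).1.1) (fun i => (piP i).1.2).
have cpi : coupling pi by split.
exists pi; split => //.
apply/lee_addgt0Pr => e e0.
apply: (lsc_dis (F := F) (fun i => (piP i).1) cpi cvg_pi sepZ p1).
apply: ooF; have := near_recip_lt e0; apply: filterS => n ne.
by rewrite (le_trans (ltW (piP n).2))// leeD2l// lee_fin ltW.
Qed.
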